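(* Let $\mathbb{X}$ be a Cartesian difference category with infinitesimal extension $\varepsilon$ and difference combinator $\boldsymbol\partial$, and let $(\mathsf{T},\mu,\eta)$ be its tangent bundle monad. Then the Kleisli category $\mathbb{X}_{\mathsf{T}}$ (with the Cartesian left additive structure described in the context) is a Cartesian difference category with infinitesimal extension $\varepsilon^{\mathsf{T}}$ and difference combinator $\boldsymbol\partial^{\mathsf{T}}$ defined, for a Kleisli map $f=\langle f_0,f_1\rangle:A\to\mathsf{T}(B)$, by $$\varepsilon^{\mathsf{T}}(f)=\varepsilon(f)=\langle\varepsilon(f_0),\varepsilon(f_1)\rangle,\qquad \boldsymbol\partial^{\mathsf{T}}[f]=\boldsymbol\partial[f]=\langle\boldsymbol\partial[f_0],\boldsymbol\partial[f_1]\rangle .$$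
   Context: Composition is written $g\circ f$ (first $f$, then $g$). A Cartesian category is a category with chosen finite products: binary products $A\times B$ with projections $\pi_0:A\times B\to A$, $\pi_1:A\times B\to B$, pairing $\langle -,-\rangle$, $f\times g=\langle f\circ\pi_0,g\circ\pi_1\rangle$, and terminal object $\top$. A left additive category is a category in which each hom-set is a commutative monoid $(+,0)$ with $(f+g)\circ h=f\circ h+g\circ h$ and $0\circ f=0$. A map $k$ is additive if $k\circ(f+g)=k\circ f+k\circ g$ and $k\circ 0=0$. A Cartesian left additive category is a Cartesian category that is also left additive and whose projections are all additive. An infinitesimal extension $\varepsilon$ on a Cartesian left additive category $\mathbb{X}$ consists of functions $\varepsilon:\mathbb{X}(A,B)\to\mathbb{X}(A,B)$ for all $A,B$ such that [E.1] $\varepsilon(f+g)=\varepsilon(f)+\varepsilon(g)$, $\varepsilon(0)=0$; [E.2] $\varepsilon(g\circ f)=\varepsilon(g)\circ f$; [E.3] $\varepsilon(\pi_i)=\pi_i\circ\varepsilon(1_{A\times B})$ for $i=0,1$. A Cartesian difference category is a Cartesian left additive category with an infinitesimal extension $\varepsilon$ and a difference combinator $\boldsymbol\partial$, assigning to each $f:A\to B$ a map $\boldsymbol\partial[f]:A\times A\to B$, such that (for all suitable maps): [C∂.0] $f\circ(x+\varepsilon(y))=f\circ x+\varepsilon(\boldsymbol\partial[f]\circ\langle x,y\rangle)$; [C∂.1] $\boldsymbol\partial[f+g]=\boldsymbol\partial[f]+\boldsymbol\partial[g]$, $\boldsymbol\partial[0]=0$, $\boldsymbol\partial[\varepsilon(f)]=\varepsilon(\boldsymbol\partial[f])$;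 [C∂.2] $\boldsymbol\partial[f]\circ\langle x,y+z\rangle=\boldsymbol\partial[f]\circ\langle x,y\rangle+\boldsymbol\partial[f]\circ\langle x+\varepsilon(y),z\rangle$, $\boldsymbol\partial[f]\circ\langle x,0\rangle=0$; [C∂.3] $\boldsymbol\partial[1_A]=\pi_1$, $\boldsymbol\partial[\pi_0]=\pi_0\circ\pi_1$, $\boldsymbol\partial[\pi_1]=\pi_1\circ\pi_1$; [C∂.4] $\boldsymbol\partial[\langle f,g\rangle]=\langle\boldsymbol\partial[f],\boldsymbol\partial[g]\rangle$; [C∂.5] $\boldsymbol\partial[g\circ f]=\boldsymbol\partial[g]\circ\langle f\circ\pi_0,\boldsymbol\partial[f]\rangle$; [C∂.6] $\boldsymbol\partial[\boldsymbol\partial[f]]\circ\langle\langle x,y\rangle,\langle 0,z\rangle\rangle=\boldsymbol\partial[f]\circ\langle x+\varepsilon(y),z\rangle$; [C∂.7] $\boldsymbol\partial[\boldsymbol\partial[f]]\circ\langle\langle x,y\rangle,\langle z,0\rangle\rangle=\boldsymbol\partial[\boldsymbol\partial[f]]\circ\langle\langle x,z\rangle,\langle y,0\rangle\rangle$. The tangent bundle monad $(\mathsf{T},\mu,\eta)$ on $\mathbb{X}$ is given by $\mathsf{T}(A)=A\times A$, $\mathsf{T}(f)=\langle f\circ\pi_0,\boldsymbol\partial[f]\rangle$, $\eta_A=\langle 1_A,0\rangle$, $\mu_A=\langle\pi_{00},\pi_{10}+\pi_{01}+\varepsilon(\pi_{11})\rangle$ with $\pi_{ij}=\pi_i\circ\pi_j$.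 The Kleisli category $\mathbb{X}_{\mathsf{T}}$ has the objects of $\mathbb{X}$; a map $A\to B$ in $\mathbb{X}_{\mathsf{T}}$ is a map $f=\langle f_0,f_1\rangle:A\to\mathsf{T}(B)$ in $\mathbb{X}$; the identity is $\eta_A$ and composition is $g\circ^{\mathsf{T}}f=\mu\circ\mathsf{T}(g)\circ f$. Its Cartesian left additive structure: the product of objects is $A\times B$ with projections $\pi_i^{\mathsf{T}}=\langle\pi_i,0\rangle$; the pairing of $f=\langle f_0,f_1\rangle$ and $g=\langle g_0,g_1\rangle$ is $\langle f,g\rangle^{\mathsf{T}}=\langle\langle f_0,g_0\rangle,\langle f_1,g_1\rangle\rangle$; the terminal object is $\top$ with unique maps $0$; the sum is $f+^{\mathsf{T}}g=f+g=\langle f_0+g_0,f_1+g_1\rangle$ and the zero map is $0^{\mathsf{T}}=0=\langle 0,0\rangle$. *)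

(* Defs.v *)
(** Every structure is a record of raw operations together with a [Prop]-valued
    record of its laws, so the Kleisli construction below acts on operations only. *)

Set Implicit Arguments.
Unset Strict Implicit.
Unset Printing Implicit Defensive.

Declare Scope cdc_scope.
Delimit Scope cdc_scope with cdc.
Open Scope cdc_scope.

Reserved Notation "g ∘ f" (at level 40, left associativity).
Reserved Notation "A ⊗ B" (at level 40, left associativity).
Reserved Notation "⟨ f , g ⟩" (at level 0, f at level 200, g at level 200).

(** ** Categories *)

Record category_data := CategoryData {
  obj :> Type;
  hom : obj -> obj -> Type;
  idm : forall A : obj, hom A A;
  comp : forall A B C : obj, hom B C -> hom A B -> hom A C
}.

Notation "g ∘ f" := (comp g f) : cdc_scope.

Record is_category (X : category_data) : Prop := {
  comp_assoc : forall (A B C D : X) (h : hom C D) (g : hom B C) (f : hom A B),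
    h ∘ (g ∘ f) = (h ∘ g) ∘ f;
  comp_id_l : forall (A B : X) (f : hom A B), idm B ∘ f = f;
  comp_id_r : forall (A B : X) (f : hom A B), f ∘ idm A = f
}.

(** ** Cartesian categories *)

Record cartesian_data := CartesianData {
  cart_cat :> category_data;
  prodo : cart_cat -> cart_cat -> cart_cat;
  proj0 : forall A B : cart_cat, hom (prodo A B) A;
  proj1 : forall A B : cart_cat, hom (prodo A B) B;
  pairm : forall A B C : cart_cat, hom C A -> hom C B -> hom C (prodo A B);
  top : cart_cat;
  bang : forall A : cart_cat, hom A top
}.

Notation "A ⊗ B" := (prodo A B) : cdc_scope.
Notation "⟨ f , g ⟩" := (pairm f g) : cdc_scope.
Notation π0 := (proj0 _ _).
Notation π1 := (proj1 _ _).

Record is_cartesian (X : cartesian_data) : Prop := {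
  cart_is_category : is_category X;
  proj0_pair : forall (A B C : X) (f : hom C A) (g : hom C B), π0 ∘ ⟨f, g⟩ = f;
  proj1_pair : forall (A B C : X) (f : hom C A) (g : hom C B), π1 ∘ ⟨f, g⟩ = g;
  pair_unique : forall (A B C : X) (f : hom C A) (g : hom C B) (h : hom C (A ⊗ B)),
    π0 ∘ h = f -> π1 ∘ h = g -> h = ⟨f, g⟩;
  bang_unique : forall (A : X) (f : hom A (top X)), f = bang A
}.

(** ** Cartesian left additive categories *)

Record cla_data := ClaData {
  cla_cart :> cartesian_data;
  addm : forall A B : cla_cart, hom A B -> hom A B -> hom A B;
  zerom : forall A B : cla_cart, hom A B
}.

Arguments zerom {c A B}.

Notation "f + g" := (addm f g) : cdc_scope.
Notation "0" := zerom : cdc_scope.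

Record is_left_additive (X : cla_data) : Prop := {
  add_assoc : forall (A B : X) (f g h : hom A B), f + (g + h) = (f + g) + h;
  add_comm : forall (A B : X) (f g : hom A B), f + g = g + f;
  add_zero_l : forall (A B : X) (f : hom A B), 0 + f = f;
  add_comp : forall (A B C : X) (f g : hom B C) (h : hom A B),
    (f + g) ∘ h = f ∘ h + g ∘ h;
  zero_comp : forall (A B C : X) (f : hom A B), (0 : hom B C) ∘ f = 0
}.

Definition additive (X : cla_data) (B C : X) (k : hom B C) : Prop :=
  (forall (A : X) (f g : hom A B), k ∘ (f + g) = k ∘ f + k ∘ g) /\
  (forall A : X, k ∘ (0 : hom A B) = 0).

Record is_cartesian_left_additive (X : cla_data) : Prop := {
  cla_is_cartesian : is_cartesian X;
  cla_is_left_additive : is_left_additive X;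
  proj0_additive : forall A B : X, additive (proj0 A B);
  proj1_additive : forall A B : X, additive (proj1 A B)
}.

(** ** Cartesian difference categories *)

Definition ext_data (X : cla_data) : Type :=
  forall A B : X, hom A B -> hom A B.

Definition diff_data (X : cla_data) : Type :=
  forall A B : X, hom A B -> hom (A ⊗ A) B.

Record is_infinitesimal_extension (X : cla_data) (eps : ext_data X) : Prop := {
  E1_add : forall (A B : X) (f g : hom A B), eps _ _ (f + g) = eps _ _ f + eps _ _ g;
  E1_zero : forall A B : X, eps A B 0 = 0;
  E2 : forall (A B C : X) (g : hom B C) (f : hom A B),
    eps _ _ (g ∘ f) = eps _ _ g ∘ f;
  E3_proj0 : forall A B : X,
    eps _ _ (proj0 A B) = proj0 A B ∘ eps _ _ (idm (A ⊗ B));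
  E3_proj1 : forall A B : X,
    eps _ _ (proj1 A B) = proj1 A B ∘ eps _ _ (idm (A ⊗ B))
}.

Record is_difference_combinator (X : cla_data) (eps : ext_data X)
    (diff : diff_data X) : Prop := {
  Cd0 : forall (A B C : X) (f : hom A B) (x y : hom C A),
    f ∘ (x + eps _ _ y) = f ∘ x + eps _ _ (diff _ _ f ∘ ⟨x, y⟩);
  Cd1_add : forall (A B : X) (f g : hom A B),
    diff _ _ (f + g) = diff _ _ f + diff _ _ g;
  Cd1_zero : forall A B : X, diff A B 0 = 0;
  Cd1_eps : forall (A B : X) (f : hom A B),
    diff _ _ (eps _ _ f) = eps _ _ (diff _ _ f);
  Cd2_add : forall (A B C : X) (f : hom A B) (x y z : hom C A),
    diff _ _ f ∘ ⟨x, y + z⟩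
    = diff _ _ f ∘ ⟨x, y⟩ + diff _ _ f ∘ ⟨x + eps _ _ y, z⟩;
  Cd2_zero : forall (A B C : X) (f : hom A B) (x : hom C A),
    diff _ _ f ∘ ⟨x, 0⟩ = 0;
  Cd3_id : forall A : X, diff _ _ (idm A) = π1;
  Cd3_proj0 : forall A B : X, diff _ _ (proj0 A B) = π0 ∘ π1;
  Cd3_proj1 : forall A B : X, diff _ _ (proj1 A B) = π1 ∘ π1;
  Cd4 : forall (A B C : X) (f : hom C A) (g : hom C B),
    diff _ _ ⟨f, g⟩ = ⟨diff _ _ f, diff _ _ g⟩;
  Cd5 : forall (A B C : X) (g : hom B C) (f : hom A B),
    diff _ _ (g ∘ f) = diff _ _ g ∘ ⟨f ∘ π0, diff _ _ f⟩;
  Cd6 : forall (A B C : X) (f : hom A B) (x y z : hom C A),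
    diff _ _ (diff _ _ f) ∘ ⟨⟨x, y⟩, ⟨0, z⟩⟩
    = diff _ _ f ∘ ⟨x + eps _ _ y, z⟩;
  Cd7 : forall (A B C : X) (f : hom A B) (x y z : hom C A),
    diff _ _ (diff _ _ f) ∘ ⟨⟨x, y⟩, ⟨z, 0⟩⟩
    = diff _ _ (diff _ _ f) ∘ ⟨⟨x, z⟩, ⟨y, 0⟩⟩
}.

Record is_cartesian_difference_category (X : cla_data) (eps : ext_data X)
    (diff : diff_data X) : Prop := {
  cdc_is_cla : is_cartesian_left_additive X;
  cdc_is_ext : is_infinitesimal_extension eps;
  cdc_is_diff : is_difference_combinator eps diff
}.

(** ** The tangent bundle monad *)

Definition tangent (X : cla_data) (A : X) : X := A ⊗ A.

Definition tangent_map (X : cla_data) (diff : diff_data X) (A B : X) (f : hom A B) :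
    hom (tangent A) (tangent B) :=
  ⟨f ∘ π0, diff _ _ f⟩.

Definition tangent_unit (X : cla_data) (A : X) : hom A (tangent A) := ⟨idm A, 0⟩.

Definition tangent_mult (X : cla_data) (eps : ext_data X) (A : X) :
    hom (tangent (tangent A)) (tangent A) :=
  ⟨π0 ∘ π0, π1 ∘ π0 + π0 ∘ π1 + eps _ _ (π1 ∘ π1)⟩.

(** ** The Kleisli category of the tangent bundle monad *)

Definition kleisli_category (X : cla_data) (eps : ext_data X) (diff : diff_data X) :
    category_data :=
  {| obj := X;
     hom := fun A B => hom A (tangent B);
     idm := fun A => tangent_unit A;
     comp := fun A B C g f => tangent_mult eps C ∘ tangent_map diff g ∘ f |}.

(** The components of a Kleisli map [f] are [π0 ∘ f] and [π1 ∘ f]. *)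
Definition kleisli_cartesian (X : cla_data) (eps : ext_data X) (diff : diff_data X) :
    cartesian_data :=
  {| cart_cat := kleisli_category eps diff;
     prodo := fun A B => prodo (c := X) A B;
     proj0 := fun A B => pairm (c := X) (proj0 (c := X) A B) 0;
     proj1 := fun A B => pairm (c := X) (proj1 (c := X) A B) 0;
     pairm := fun A B C (f : hom (c := X) C (tangent A)) (g : hom (c := X) C (tangent B)) =>
       ⟨⟨π0 ∘ f, π0 ∘ g⟩, ⟨π1 ∘ f, π1 ∘ g⟩⟩;
     top := top X;
     bang := fun A => zerom (c := X) (A := A) (B := tangent (top X)) |}.

Definition kleisli (X : cla_data) (eps : ext_data X) (diff : diff_data X) : cla_data :=
  {| cla_cart := kleisli_cartesian eps diff;
     addm := fun A B f g => addm (c := X) (A := A) (B := tangent B) f g;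
     zerom := fun A B => zerom (c := X) (A := A) (B := tangent B) |}.

Definition kleisli_ext (X : cla_data) (eps : ext_data X) (diff : diff_data X) :
    ext_data (kleisli eps diff) :=
  fun A B f => eps A (tangent B) f.

Definition kleisli_diff (X : cla_data) (eps : ext_data X) (diff : diff_data X) :
    diff_data (kleisli eps diff) :=
  fun A B f => diff A (tangent B) f.

Arguments kleisli_ext [X] eps diff A B f.
Arguments kleisli_diff [X] eps diff A B f.

(* Main.v *)
Require Import Defs.

(** In components, Kleisli composition reads
    [(g0, g1) ∘ (f0, f1) = (g0 ∘ f0, ∂g0 ∘ ⟨f0, f1⟩ + g1 ∘ (f0 + ε f1))].
    The key fact is that axioms 2, 6 and 7 give the full interchange symmetry
    [∂∂f ∘ ⟨⟨x, y⟩, ⟨z, w⟩⟩ = ∂∂f ∘ ⟨⟨x, z⟩, ⟨y, w⟩⟩]. The first component of each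
    axiom for [∂] is the same axiom in the base; in the second component the [g1]
    part is again that axiom, evaluated at [f0 + ε f1], and the [∂g0] part is, up to
    interchange, the axiom for [∂g0] (axioms 0, 2, 5) or the derivative of the axiom
    for [g0] (axioms 6, 7). *)

Set Implicit Arguments.
Unset Strict Implicit.
Unset Printing Implicit Defensive.

Section Base.

Variables (X : cla_data) (eps : ext_data X) (diff : diff_data X).
Hypothesis HX : is_cartesian_difference_category eps diff.

Local Notation "'ε' f" := (@eps _ _ f) (at level 30, right associativity).
Local Notation "'∂' f" := (@diff _ _ f) (at level 30, right associativity).

Let Hcla := cdc_is_cla HX.
Let Hcart := cla_is_cartesian Hcla.
Let Hcat := cart_is_category Hcart.
Let Hadd := cla_is_left_additive Hcla.
Let Hext := cdc_is_ext HX.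
Let Hdiff := cdc_is_diff HX.

Lemma comp_assoc_r (A B C D : X) (h : hom C D) (g : hom B C) (f : hom A B) :
  (h ∘ g) ∘ f = h ∘ (g ∘ f).
Proof. symmetry; apply (comp_assoc Hcat). Qed.

Lemma pair_surj (A B C : X) (h : hom C (A ⊗ B)) : h = ⟨π0 ∘ h, π1 ∘ h⟩.
Proof. now apply (pair_unique Hcart). Qed.

Lemma pair_comp (A B C D : X) (f : hom C A) (g : hom C B) (h : hom D C) :
  ⟨f, g⟩ ∘ h = ⟨f ∘ h, g ∘ h⟩.
Proof.
  apply (pair_unique Hcart); rewrite (comp_assoc Hcat).
  - now rewrite (proj0_pair Hcart).
  - now rewrite (proj1_pair Hcart).
Qed.

Lemma proj0_add (A B C : X) (f g : hom C (A ⊗ B)) : π0 ∘ (f + g) = π0 ∘ f + π0 ∘ g.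
Proof. apply (proj0_additive Hcla A B). Qed.

Lemma proj1_add (A B C : X) (f g : hom C (A ⊗ B)) : π1 ∘ (f + g) = π1 ∘ f + π1 ∘ g.
Proof. apply (proj1_additive Hcla A B). Qed.

Lemma proj0_zero (A B C : X) : proj0 A B ∘ (0 : hom C (A ⊗ B)) = 0.
Proof. apply (proj0_additive Hcla A B). Qed.

Lemma proj1_zero (A B C : X) : proj1 A B ∘ (0 : hom C (A ⊗ B)) = 0.
Proof. apply (proj1_additive Hcla A B). Qed.

Lemma add_zero_r (A B : X) (f : hom A B) : f + 0 = f.
Proof. rewrite (add_comm Hadd); apply (add_zero_l Hadd). Qed.

Lemma add_swap (A B : X) (a b c d : hom A B) : (a + b) + (c + d) = (a + c) + (b + d).
Proof.
  rewrite <- !(add_assoc Hadd); f_equal.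
  rewrite !(add_assoc Hadd); f_equal; apply (add_comm Hadd).
Qed.

Lemma pair_add (A B C : X) (f f' : hom C A) (g g' : hom C B) :
  ⟨f, g⟩ + ⟨f', g'⟩ = ⟨f + f', g + g'⟩.
Proof.
  apply (pair_unique Hcart).
  - now rewrite proj0_add, !(proj0_pair Hcart).
  - now rewrite proj1_add, !(proj1_pair Hcart).
Qed.

Lemma pair_zero (A B C : X) : ⟨(0 : hom C A), (0 : hom C B)⟩ = 0.
Proof.
  symmetry; apply (pair_unique Hcart); [apply proj0_zero | apply proj1_zero].
Qed.

Lemma eps_comp (A B C : X) (g : hom B C) (f : hom A B) : (ε g) ∘ f = ε (g ∘ f).
Proof. symmetry; apply (E2 Hext). Qed.

Lemma proj0_eps (A B C : X) (h : hom C (A ⊗ B)) : π0 ∘ ε h = ε (π0 ∘ h).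
Proof.
  rewrite (E2 Hext), (E3_proj0 Hext), comp_assoc_r, eps_comp.
  now rewrite (comp_id_l Hcat).
Qed.

Lemma proj1_eps (A B C : X) (h : hom C (A ⊗ B)) : π1 ∘ ε h = ε (π1 ∘ h).
Proof.
  rewrite (E2 Hext), (E3_proj1 Hext), comp_assoc_r, eps_comp.
  now rewrite (comp_id_l Hcat).
Qed.

Lemma eps_pair (A B C : X) (f : hom C A) (g : hom C B) : ε ⟨f, g⟩ = ⟨ε f, ε g⟩.
Proof.
  apply (pair_unique Hcart).
  - now rewrite proj0_eps, (proj0_pair Hcart).
  - now rewrite proj1_eps, (proj1_pair Hcart).
Qed.

Lemma diff_proj0_comp (A B C : X) (h : hom C (A ⊗ B)) : ∂ (π0 ∘ h) = π0 ∘ ∂ h.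
Proof.
  now rewrite (Cd5 Hdiff), (Cd3_proj0 Hdiff), comp_assoc_r, (proj1_pair Hcart).
Qed.

Lemma diff_proj1_comp (A B C : X) (h : hom C (A ⊗ B)) : ∂ (π1 ∘ h) = π1 ∘ ∂ h.
Proof.
  now rewrite (Cd5 Hdiff), (Cd3_proj1 Hdiff), comp_assoc_r, (proj1_pair Hcart).
Qed.

(** Since [⟨z, w⟩ = ⟨z, 0⟩ + ⟨0, w⟩], axiom 2 for [∂ f] moves the second summand to the base point
    [⟨x + ε z, y⟩], where axiom 6 removes one derivative. *)
Lemma diff2_pair (A B C : X) (f : hom A B) (x y z w : hom C A) :
  ∂ ∂ f ∘ ⟨⟨x, y⟩, ⟨z, w⟩⟩ =
  ∂ ∂ f ∘ ⟨⟨x, y⟩, ⟨z, 0⟩⟩ + ∂ f ∘ ⟨(x + ε z) + ε y, w⟩.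
Proof.
  replace ⟨z, w⟩ with (⟨z, 0⟩ + ⟨0, w⟩)
    by now rewrite pair_add, add_zero_r, (add_zero_l Hadd).
  rewrite (Cd2_add Hdiff), eps_pair, (E1_zero Hext), pair_add, add_zero_r.
  now rewrite (Cd6 Hdiff).
Qed.

(** In [diff2_pair] the first summand is symmetric in [y] and [z] by axiom 7, the second by
    commutativity. The symmetry is needed because Kleisli pairing produces [⟨⟨x0, y0⟩, ⟨x1, y1⟩⟩],
    the transpose of [⟨⟨x0, x1⟩, ⟨y0, y1⟩⟩]. *)
Lemma diff2_interchange (A B C : X) (f : hom A B) (x y z w : hom C A) :
  ∂ ∂ f ∘ ⟨⟨x, y⟩, ⟨z, w⟩⟩ = ∂ ∂ f ∘ ⟨⟨x, z⟩, ⟨y, w⟩⟩.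
Proof.
  rewrite (diff2_pair f x y z w), (diff2_pair f x z y w), (Cd7 Hdiff f x y z); do 3 f_equal.
  rewrite <- !(add_assoc Hadd); f_equal; apply (add_comm Hadd).
Qed.

Lemma kleisli_comp (A B C : X) (g : hom B (tangent C)) (f : hom A (tangent B)) :
  tangent_mult eps C ∘ tangent_map diff g ∘ f =
  ⟨(π0 ∘ g) ∘ (π0 ∘ f), ∂ (π0 ∘ g) ∘ f + (π1 ∘ g) ∘ (π0 ∘ f + ε (π1 ∘ f))⟩.
Proof.
  unfold tangent_mult, tangent_map, tangent in *.
  (* Axiom 0 splits the last term on the right in two, matching the summands [π1 ∘ π0] and
     [ε (π1 ∘ π1)] of the multiplication. *)
  rewrite (Cd0 Hdiff), <- pair_surj, diff_proj0_comp, (Cd5 Hdiff), (Cd3_proj1 Hdiff).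
  repeat (rewrite ?pair_comp, ?comp_assoc_r, ?(add_comp Hadd), ?eps_comp,
    ?(proj0_pair Hcart), ?(proj1_pair Hcart)).
  f_equal; rewrite !(add_assoc Hadd); f_equal; apply (add_comm Hadd).
Qed.

(* Obtained by differentiating axiom 6 at the generic point of [(A ⊗ A) ⊗ A]. *)
Lemma diff3_axiom6 (A B C : X) (f : hom A B) (x y z x' y' z' : hom C A) :
  ∂ ∂ ∂ f ∘ ⟨⟨⟨x, y⟩, ⟨0, z⟩⟩, ⟨⟨x', y'⟩, ⟨0, z'⟩⟩⟩ =
  ∂ ∂ f ∘ ⟨⟨x + ε y, z⟩, ⟨x' + ε y', z'⟩⟩.
Proof.
  set (p := proj0 (A ⊗ A) A).
  pose proof (Cd6 Hdiff f (π0 ∘ p) (π1 ∘ p) (proj1 (A ⊗ A) A)) as H.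
  (* Unprimed variables form the base point, primed ones the direction. *)
  apply (f_equal (fun h => ∂ h ∘ ⟨⟨⟨x, y⟩, z⟩, ⟨⟨x', y'⟩, z'⟩⟩)) in H.
  subst p; revert H.
  rewrite !(Cd5 Hdiff), !(Cd4 Hdiff), !(Cd1_add Hdiff), !(Cd1_eps Hdiff),
    !(Cd1_zero Hdiff), !diff_proj0_comp, !diff_proj1_comp,
    !(Cd3_proj0 Hdiff), !(Cd3_proj1 Hdiff).
  repeat (rewrite ?pair_comp, ?comp_assoc_r, ?(add_comp Hadd), ?eps_comp,
    ?(zero_comp Hadd), ?(proj0_pair Hcart), ?(proj1_pair Hcart)).
  exact (fun H => H).
Qed.

(* Obtained by differentiating axiom 7 at the generic point of [(A ⊗ A) ⊗ A]. *)
Lemma diff3_axiom7 (A B C : X) (f : hom A B) (x y z x' y' z' : hom C A) :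
  ∂ ∂ ∂ f ∘ ⟨⟨⟨x, y⟩, ⟨z, 0⟩⟩, ⟨⟨x', y'⟩, ⟨z', 0⟩⟩⟩ =
  ∂ ∂ ∂ f ∘ ⟨⟨⟨x, z⟩, ⟨y, 0⟩⟩, ⟨⟨x', z'⟩, ⟨y', 0⟩⟩⟩.
Proof.
  set (p := proj0 (A ⊗ A) A).
  pose proof (Cd7 Hdiff f (π0 ∘ p) (π1 ∘ p) (proj1 (A ⊗ A) A)) as H.
  apply (f_equal (fun h => ∂ h ∘ ⟨⟨⟨x, y⟩, z⟩, ⟨⟨x', y'⟩, z'⟩⟩)) in H.
  subst p; revert H.
  rewrite !(Cd5 Hdiff), !(Cd4 Hdiff),
    !(Cd1_zero Hdiff), !diff_proj0_comp, !diff_proj1_comp,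
    !(Cd3_proj0 Hdiff), !(Cd3_proj1 Hdiff).
  repeat (rewrite ?pair_comp, ?comp_assoc_r,
    ?(zero_comp Hadd), ?(proj0_pair Hcart), ?(proj1_pair Hcart)).
  exact (fun H => H).
Qed.

(** Replaces every map into a product by a pair of fresh components, so that Kleisli laws become
    equations in the base. *)
Ltac split_kleisli :=
  intros; subst; unfold kleisli_ext, kleisli_diff; cbn in *; rewrite ?kleisli_comp;
  unfold tangent_unit, tangent in *; cbn in *;
  repeat match goal with
  | f : hom _ (_ ⊗ _) |- _ =>
      let f0 := fresh f "0" in let f1 := fresh f "1" in
      rewrite (pair_surj f);
      generalize (π0 ∘ f) (π1 ∘ f); clear f; intros f0 f1
  end.

(** Axioms 0, 5, 6, 7 and the sum clause of axiom 2 are left out; they are applied by hand, in the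
    direction each law requires. *)
Ltac normalize :=
  repeat (rewrite ?pair_comp, ?comp_assoc_r, ?(add_comp Hadd),
    ?eps_comp, ?(zero_comp Hadd), ?(proj0_pair Hcart), ?(proj1_pair Hcart),
    ?(comp_id_l Hcat), ?(comp_id_r Hcat), ?(Cd2_zero Hdiff), ?(Cd3_id Hdiff),
    ?(Cd3_proj0 Hdiff), ?(Cd3_proj1 Hdiff), ?(Cd4 Hdiff), ?(Cd1_add Hdiff),
    ?(Cd1_zero Hdiff), ?(Cd1_eps Hdiff), ?(E1_add Hext), ?(E1_zero Hext),
    ?eps_pair, ?proj0_eps, ?proj1_eps, ?proj0_add, ?proj1_add, ?proj0_zero,
    ?proj1_zero, ?pair_add, ?pair_zero, ?add_zero_r, ?(add_zero_l Hadd)).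

Lemma kleisli_is_category : is_category (kleisli_category eps diff).
Proof.
  constructor; split_kleisli; normalize; trivial.
  (* Only associativity is left, in its second component. Axiom 2 splits the derivative of the outer
     map, and axiom 0 read backwards turns the base point into [g0 ∘ (f0 + ε f1)]. *)
  f_equal.
  rewrite (Cd2_add Hdiff), (add_assoc Hadd (g0 ∘ f0)), <- (Cd0 Hdiff g0).
  now rewrite (Cd5 Hdiff), comp_assoc_r, pair_comp, comp_assoc_r, (proj0_pair Hcart),
    <- (add_assoc Hadd).
Qed.

Lemma kleisli_is_cartesian : is_cartesian (kleisli_cartesian eps diff).
Proof.
  constructor; [exact kleisli_is_category | ..]; split_kleisli; normalize; trivial.
  (* Left is uniqueness of maps to the terminal object: both components equal the unique base map,
     which is [0]. *)
  now rewrite (bang_unique Hcart f0), (bang_unique Hcart f1),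
    <- (bang_unique Hcart 0), pair_zero.
Qed.

Lemma kleisli_is_cla : is_cartesian_left_additive (kleisli eps diff).
Proof.
  constructor; [exact kleisli_is_cartesian | constructor | |].
  all: unfold additive; repeat split; split_kleisli; normalize; trivial; f_equal.
  1-2: apply (add_assoc Hadd).
  1-2: apply (add_comm Hadd).
  apply add_swap.
Qed.

Lemma kleisli_is_ext : is_infinitesimal_extension (kleisli_ext eps diff).
Proof. constructor; split_kleisli; normalize; trivial. Qed.

Lemma kleisli_is_diff :
  is_difference_combinator (kleisli_ext eps diff) (kleisli_diff eps diff).
Proof.
  constructor; split_kleisli; normalize; trivial.
  - f_equal; [apply (Cd0 Hdiff) |].
    (* Axiom 0 for [∂ f0] at [⟨x0, x1⟩ + ε ⟨y0, y1⟩]; below, for [f1] at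
       [(x0 + ε x1) + ε (y0 + ε y1)]. *)
    rewrite <- pair_add, <- eps_pair, (Cd0 Hdiff).
    rewrite add_swap, <- (E1_add Hext), (Cd0 Hdiff), (diff2_interchange f0 x0 y0).
    apply add_swap.
  - f_equal; [apply (Cd2_add Hdiff) |].
    (* Interchange makes [⟨y0, y1⟩ + ⟨z0, z1⟩] the direction of [∂ ∂ f0], so that axiom 2 for [∂ f0]
       applies. *)
    rewrite (add_swap y0), (Cd2_add Hdiff f1), (diff2_interchange f0 x0), <- pair_add.
    rewrite (Cd2_add Hdiff), eps_pair, pair_add.
    rewrite (E1_add Hext), (add_swap x0 (ε x1)).
    rewrite (diff2_interchange f0 x0 y0), (diff2_interchange f0 (x0 + ε y0) z0).
    apply add_swap.
  - now rewrite diff2_interchange, pair_zero, (Cd2_zero Hdiff), pair_zero.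
  - f_equal; [apply (Cd5 Hdiff) |].
    rewrite !(Cd5 Hdiff); normalize.
    now rewrite diff2_interchange.
  - f_equal; [apply (Cd6 Hdiff) |].
    (* Kleisli pairing already puts [x1], [y1], [z1] in the direction slot, as the primed variables
       of [diff3_axiom6], so no interchange occurs. *)
    now rewrite diff3_axiom6, (Cd6 Hdiff), add_swap, (E1_add Hext), (add_swap x0).
  - f_equal; [apply (Cd7 Hdiff) |].
    now rewrite diff3_axiom7, (Cd7 Hdiff).
Qed.

End Base.

Theorem proposition6p13 (X : cla_data) (eps : ext_data X) (diff : diff_data X)
    (HX : is_cartesian_difference_category eps diff) :
  is_cartesian_difference_category (kleisli_ext eps diff) (kleisli_diff eps diff) /\
  (forall (A B : X) (f : hom A (tangent B)) (f0 f1 : hom A B),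
    f = ⟨f0, f1⟩ ->
    (kleisli_ext eps diff A B f = eps A (tangent B) f /\
     eps A (tangent B) f = ⟨eps A B f0, eps A B f1⟩) /\
    (kleisli_diff eps diff A B f = diff A (tangent B) f /\
     diff A (tangent B) f = ⟨diff A B f0, diff A B f1⟩)).
Proof.
  split.
  - constructor.
    + exact (kleisli_is_cla HX).
    + exact (kleisli_is_ext HX).
    + exact (kleisli_is_diff HX).
  - intros A B f f0 f1 ->; repeat split.
    + apply (eps_pair HX).
    + apply (Cd4 (cdc_is_diff HX)).
Qed.
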